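(* Let $\alpha$ be a constant with $1/2<\alpha<1$. Then the diameter of a random Cayley digraph on an elementary abelian group of order $n$ and degree $\lfloor n^{\alpha}\rfloor$ is asymptotically almost surely equal to two. That is, for every $\varepsilon>0$ there exists $N$ such that for every elementary abelian group $G$ of order $n\ge N$, if $S$ is a uniformly random subset of $G\setminus\{1\}$ of size $\lfloor n^{\alpha}\rfloor$, then $$\Pr\big(\operatorname{diam}(\operatorname{Cay}(G,S))=2\big)\ge 1-\varepsilon .$$
   Context: An elementary abelian group is a group isomorphic to $\mathbb{Z}_p^d$ for some prime $p$ and integer $d\ge 1$. For a finite group $G$ and a subset $S\subseteq G\setminus\{1\}$, the Cayley digraph $\operatorname{Cay}(G,S)$ has vertex set $G$ and arc set $\{(g,gs): g\in G, s\in S\}$. The distance from $g$ to $h$ is the length of the shortest directed path from $g$ to $h$ (infinite if there is none). The diameter $\operatorname{diam}(\operatorname{Cay}(G,S))$ is the smallest integer $d$ such that for every ordered pair $(g,h)$ the distance from $g$ to $h$ is at most $d$ (and is $\infty$ if no such $d$ exists). A random Cayley digraph on $G$ of degree $k$, $1\le k\le |G|-1$, is $\operatorname{Cay}(G,S)$ with $S$ chosen uniformly among all $k$-element subsets of $G\setminus\{1\}$. *)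

(* Defs.v *)
From mathcomp Require Import all_boot all_order all_fingroup all_algebra.
From mathcomp Require Import all_solvable all_field all_character.
From mathcomp Require Import boolp reals exp.

Set Implicit Arguments.
Unset Strict Implicit.
Unset Printing Implicit Defensive.

Import GroupScope.

(* The case d = 0, i.e. the trivial group, is excluded. *)
Definition elementary_abelian (gT : finGroupType) : Prop :=
  exists p d : nat,
    [/\ prime p, (0 < d)%N & [set: gT] \isog [set: 'rV['F_p]_d] ].

Lemma elementary_abelianE (gT : finGroupType) :
  elementary_abelian gT <->
  [set: gT] != 1 /\ is_abelem [set: gT].
Proof.
split=> [[p [d [p_pr d_gt0 isoG]]] | [ntG abG]].
  have abV : p.-abelem [set: 'rV['F_p]_d] by exact: mx_Fp_abelem.
  have abG : p.-abelem [set: gT] by rewrite (isog_abelem isoG).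
  have ntG : [set: gT] != 1.
    rewrite -cardG_gt1 (card_isog isoG) cardsT card_mx mul1n card_Fp //.
    by rewrite -(exp1n d) ltn_exp2r // prime_gt1.
  by split=> //; apply/is_abelemP; exists p.
have [p p_pr abGp] := is_abelemP abG.
exists p, (logn p #|[set: gT]|); split=> //.
  rewrite logn_gt0 mem_primes p_pr cardG_gt0 /=.
  by have [_ pG _] := pgroup_pdiv (abelem_pgroup abGp) ntG.
rewrite (isog_abelem_card _ abGp) mx_Fp_abelem //=.
rewrite [#|[set: 'rV_ _]|]cardsT card_mx mul1n card_Fp //.
by rewrite -card_pgroup ?(abelem_pgroup abGp).
Qed.

(* [None] stands for infinity. *)
Definition least (P : pred nat) : option nat :=
  if pselect (exists n, P n) is left exP then Some (ex_minn exP) else None.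

Section Digraph.

Variables (T : finType) (e : rel T).

(* [path] allows repeated vertices; this does not change the least length. *)
Definition dist (x y : T) : option nat :=
  least (fun n => [exists p : n.-tuple T, path e x p && (last x p == y)]).

Definition dist_le (x y : T) (d : nat) : bool :=
  if dist x y is Some n then (n <= d)%N else false.

Definition diam : option nat :=
  least (fun d => [forall x, forall y, dist_le x y d]).

End Digraph.

Definition Cay (gT : finGroupType) (S : {set gT}) : rel gT :=
  [rel g h | h \in [set g * s | s in S] ].

Definition connection_sets (gT : finGroupType) (k : nat) : {set {set gT}} :=
  [set S : {set gT} | (S \subset [set~ 1]) && (#|S| == k)].

(* The probability of [A] for the uniform distribution on [Omega]. *)
Definition unif_prob (R : realType) (T : finType) (Omega A : {set T}) : R :=
  (#|Omega :&: A|%:R / #|Omega|%:R)%R.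

(* Main.v *)
Require Import Defs.
From mathcomp Require Import all_boot all_order all_fingroup all_algebra.
From mathcomp Require Import boolp reals exp.
From mathcomp Require Import sequences ring lra zify.

Set Implicit Arguments.
Unset Strict Implicit.
Unset Printing Implicit Defensive.

Import Order.TTheory GRing.Theory Num.Theory.
Local Open Scope ring_scope.

(** For fixed [g], a set [S] with [g] not in [S * S] is disjoint from its image
    under the injection [s |-> g * s^-1].  Building such an [S] one element at a
    time, the [(i+1)]-st element has to avoid about [2 i] elements instead of
    [i], so a uniform [k]-set has this property with probability at most
    [exp (- k (k - 3) / (2 (n - 1)))].  For [k ~ n ^ alpha] with [alpha > 1/2]
    this beats the factor [n] of the union bound over [g], so almost surely
    every element is a product of two elements of [S].  As [k < n - 1], the
    diameter is not smaller than two. *)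

(** * Walks and the diameter of a Cayley digraph *)

Lemma least_eq (P : pred nat) n :
  P n -> (forall m, (m < n)%N -> ~~ P m) -> least P = Some n.
Proof.
move=> Pn Pmin; rewrite /least; case: pselect => [exP|[]]; last by exists n.
case: ex_minnP => m Pm m_min; congr Some; apply/eqP.
rewrite eqn_leq m_min //= leqNgt; apply/negP => /Pmin.
by rewrite Pm.
Qed.

Lemma dist_leP (T : finType) (e : rel T) x y d :
  reflect (exists p : seq T, [/\ (size p <= d)%N, path e x p & last x p = y])
          (dist_le e x y d).
Proof.
rewrite /dist_le /dist /least; case: pselect => [exP|nexP]; last first.
  constructor; case=> p [_ ep lp]; case: nexP; exists (size p).
  by apply/existsP; exists (in_tuple p); rewrite ep lp eqxx.
case: ex_minnP => m ePm m_min.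
apply: (iffP idP) => [le_md | [q [le_qd eq lq]]].
  case/existsP: ePm => p /andP[ep /eqP lp].
  by exists p; rewrite size_tuple.
apply: leq_trans le_qd; apply: m_min; apply/existsP; exists (in_tuple q).
by rewrite eq lq eqxx.
Qed.

Section Cayley.

Variables (gT : finGroupType) (S : {set gT}).

Lemma CayE g h : Cay S g h = ((g^-1 * h)%g \in S).
Proof.
apply/imsetP/idP => [[s sS ->]|]; first by rewrite mulKg.
by move=> sS; exists (g^-1 * h)%g; rewrite ?mulKVg.
Qed.

(** If [x^-1 * y = s * t] with [s], [t] in [S], then [x], [x * s], [y] is a walk of length two. By
    the size hypothesis some [g] lies outside [S] and differs from [1], so it is not within distance
    one of [1]. *)
Lemma diam_Cay_eq2 :
  (#|S|.+1 < #|gT|)%N ->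
  (forall g, exists2 s, s \in S & (s^-1 * g)%g \in S) ->
  diam (Cay S) = Some 2%N.
Proof.
move=> ltSG prodS; apply: least_eq => [|d lt_d2].
  apply/forallP => x; apply/forallP => y; apply/dist_leP.
  have [s sS tS] := prodS (x^-1 * y)%g.
  exists [:: (x * s)%g; y]; split=> //=.
  by rewrite !CayE mulKg sS /= invMg -mulgA tS.
have [g] : exists g, g \notin 1%g |: S.
  apply/existsP; rewrite -negb_forall; apply/negP => /forallP allG.
  move: ltSG; rewrite ltnNge => /negP[].
  rewrite -cardsT -[#|S|.+1]add1n.
  apply: (@leq_trans #|1%g |: S|); first by apply/subset_leq_card/subsetP.
  by rewrite cardsU1 leq_add2r; case: (_ \notin _).
rewrite !inE negb_or => /andP[g1 gS]; apply/negP => /forallP/(_ 1%g).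
move=> /forallP/(_ g)/dist_leP[p [le_pd]].
have: (size p <= 1)%N by apply: leq_trans le_pd _.
case: p {le_pd} => [|h [|//]] _ /=.
  by move=> _ g_1; rewrite -g_1 eqxx in g1.
by rewrite CayE invg1 mul1g andbT => hS hg; rewrite -hg hS in gS.
Qed.

End Cayley.

(** * Counting sets disjoint from their image *)

Section Avoiding.

Variables (T : finType) (f : T -> T) (u : T).
Hypothesis f_inj : injective f.

(** With [u = 1] and [f x = g * x^-1] these are the connection sets of size [k] for which [g] is not
    a product of two elements. *)
Definition avoiding_sets (k : nat) : {set {set T}} :=
  [set S : {set T} | [&& S \subset [set~ u], #|S| == k & [disjoint S & f @: S]]].

Lemma card_avoiding_sets_extend k S : S \in avoiding_sets k ->
  (#|[set~ u] :\: (S :|: f @: S)| <= #|T| - k.*2)%N.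
Proof.
rewrite inE => /and3P[_ /eqP cS dS].
apply: (@leq_trans #|~: (S :|: f @: S)|).
  by apply/subset_leq_card; rewrite setDE subsetIr.
rewrite cardsCs setCK cardsU disjoint_setI0 // cards0 subn0.
by rewrite card_imset // cS addnn.
Qed.

(** Double counting of pairs [(S, x)] with [x] in [S]: removing [x] leaves an avoiding set, and [x]
    lies neither in it nor in its image. Only an inequality results, since the condition that [f x]
    avoids [S] is dropped. *)
Lemma card_avoiding_setsS k :
  (k.+1 * #|avoiding_sets k.+1| <= #|avoiding_sets k| * (#|T| - k.*2))%N.
Proof.
pose D := [set q : {set T} * T | (q.1 \in avoiding_sets k.+1) && (q.2 \in q.1)].
pose E := [set q : {set T} * T |
  (q.1 \in avoiding_sets k) && (q.2 \in [set~ u] :\: (q.1 :|: f @: q.1))].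
have cardD : #|D| = (k.+1 * #|avoiding_sets k.+1|)%N.
  rewrite -sum1_card (eq_bigl _ _ (in_set _)).
  rewrite -(pair_big_dep (fun S => S \in avoiding_sets k.+1)
    (fun (S : {set T}) x => x \in S) (fun _ _ => 1%N)) /=.
  rewrite mulnC -sum_nat_const; apply: eq_bigr => S.
  by rewrite sum1_card inE => /and3P[_ /eqP].
have leE : (#|E| <= #|avoiding_sets k| * (#|T| - k.*2))%N.
  rewrite -sum1_card (eq_bigl _ _ (in_set _)).
  rewrite -(pair_big_dep (fun S => S \in avoiding_sets k) (fun (S : {set T}) x =>
    x \in [set~ u] :\: (S :|: f @: S)) (fun _ _ => 1%N)) /=.
  rewrite -sum_nat_const; apply: leq_sum => S aS.
  by rewrite sum1_card card_avoiding_sets_extend.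
rewrite -cardD; apply: leq_trans leE.
pose h (q : {set T} * T) := (q.1 :\ q.2, q.2).
have h_inj : {in D &, injective h}.
  move=> [S x] [S' x']; rewrite !inE /= => /andP[_ xS] /andP[_ xS'] [eqS eqx].
  by rewrite -eqx in xS' eqS *; rewrite -(setD1K xS) eqS setD1K.
rewrite -(card_in_imset h_inj); apply/subset_leq_card/subsetP => _ /imsetP[[S x] qD ->].
move: qD; rewrite inE /= => /andP[]; rewrite inE => /and3P[sSU /eqP cS dS] xS.
rewrite !inE /= eqxx /= (subset_trans (subsetDl _ _) sSU) /=.
have := subsetP sSU x xS; rewrite !inE => -> /=; rewrite andbT.
have sDS := subsetDl S [set x].
rewrite (disjointWl sDS (disjointWr (imsetS f sDS) dS)) andbT.
move: cS; rewrite (cardsD1 x) xS add1n => /succn_inj ->; rewrite eqxx /=.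
apply/negP => /(subsetP (imsetS f sDS)).
by rewrite (disjointFr dS xS).
Qed.

(** Each added element multiplies the proportion of avoiding sets by at most [expR (- (i - 1) / N)],
    where [N = #|T| - 1], and the sum of [i - 1] over [i < k] is [k (k - 3) / 2]. *)
Lemma card_avoiding_sets_le (R : realType) k : (k <= #|T|.-1)%N ->
  #|avoiding_sets k|%:R <=
    expR (- (k%:R * (k%:R - 3) / (2 * #|T|.-1%:R))) * 'C(#|T|.-1, k)%:R :> R.
Proof.
have [N cT] : exists N, #|T| = N.+1.
  by exists #|T|.-1; rewrite prednK //; apply/card_gt0P; exists u.
rewrite cT /=; elim: k => [_|k IHk ltkN].
  rewrite !mul0r oppr0 expR0 mul1r bin0 ler_nat.
  apply: (@leq_trans #|[set (set0 : {set T})]|); last by rewrite cards1.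
  apply/subset_leq_card/subsetP => S.
  by rewrite !inE => /and3P[_]; rewrite cards_eq0.
have N0 : 0 < N%:R :> R by rewrite ltr0n; apply: leq_ltn_trans ltkN.
have kN : k%:R <= N%:R :> R by rewrite ler_nat ltnW.
have step : (N.+1 - k.*2)%:R <= (N - k)%:R * expR (- ((k%:R - 1) / N%:R)) :> R.
  (* When [N + 1 <= 2 k] the truncated difference on the left is zero. *)
  have [le_Nk|lt_kN] := leqP N.+1 k.*2.
    by rewrite (eqP le_Nk) mulr_ge0 ?expR_ge0.
  apply: (@le_trans _ _ ((N - k)%:R * (1 - (k%:R - 1) / N%:R))); last first.
    by rewrite ler_wpM2l // expR_ge1Dx.
  rewrite !natrB ?(ltnW lt_kN) ?(ltnW ltkN) // -subr_ge0 -muln2 natrM -natr1.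
  have -> : (N%:R - k%:R) * (1 - (k%:R - 1) / N%:R) - (N%:R + 1 - k%:R * 2)
    = k%:R * (k%:R - 1) / N%:R :> R by field; rewrite gt_eqF.
  (* For [k = 0] the factor [k - 1] is negative, but the product vanishes. *)
  rewrite divr_ge0 ?ler0n //; case: (k) => [|m]; first by rewrite mul0r.
  by rewrite mulr_ge0 // subr_ge0 ler1n.
have k0 : 0 < k.+1%:R :> R by rewrite ltr0n.
rewrite -(ler_pM2l k0) -[leLHS]natrM.
have := card_avoiding_setsS k; rewrite cT -(ler_nat R) => /le_trans; apply.
rewrite [leRHS]mulrCA -[X in _ <= _ * X]natrM mul_bin_left !natrM.
apply: le_trans (ler_pM _ _ (IHk (ltnW ltkN)) step) _ => //.
rewrite le_eqVlt; apply/orP; left; apply/eqP.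
rewrite [LHS](_ : _ = (expR (- (k%:R * (k%:R - 3) / (2 * N%:R))) *
  expR (- ((k%:R - 1) / N%:R))) * ((N - k)%:R * 'C(N, k)%:R)); last by ring.
(* The exponents match because [k (k - 3) + 2 (k - 1) = (k + 1) (k - 2)]. *)
rewrite -expRD; congr (expR _ * _); rewrite -natr1; field.
by rewrite gt_eqF.
Qed.

End Avoiding.

(** * Union bound over the group elements *)

Lemma connection_sets_diam_neq2_sub (gT : finGroupType) k :
  (k < #|gT|.-1)%N ->
  connection_sets gT k :\: [set S : {set gT} | diam (Cay S) == Some 2%N]
    \subset \bigcup_(g : gT) avoiding_sets (fun x => g * x^-1)%g 1%g k.
Proof.
move=> lt_kG; apply/subsetP => S; rewrite !inE => /andP[diamS /andP[sS cS]].
apply: contraR diamS => nS; apply/eqP/diam_Cay_eq2.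
  by rewrite (eqP cS); lia.
move=> g; have : S \notin avoiding_sets (fun x => g * x^-1)%g 1%g k.
  by apply: contra nS => aS; apply/bigcupP; exists g.
rewrite inE sS cS /= => /pred0Pn[s /= /andP[sS' /imsetP[t tS s_def]]].
by exists s => //; rewrite s_def invMg invgK -mulgA mulVg mulg1.
Qed.

Lemma diam2_prob_ge (R : realType) (gT : finGroupType) k :
  (k < #|gT|.-1)%N ->
  1 - #|gT|%:R * expR (- (k%:R * (k%:R - 3) / (2 * #|gT|.-1%:R))) <=
    unif_prob R (connection_sets gT k)
      [set S : {set gT} | diam (Cay S) == Some 2%N].
Proof.
move=> lt_kG; rewrite /unif_prob.
set Omega := connection_sets gT k; set A := [set S : {set gT} | _].
set b := expR _.
have cO : #|Omega| = 'C(#|gT|.-1, k) by rewrite cards_draws cardsC1.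
have O0 : 0 < #|Omega|%:R :> R by rewrite ltr0n cO bin_gt0 ltnW.
rewrite ler_pdivlMr // mulrBl mul1r lerBlDr -{1}(cardsID A Omega) natrD lerD2l.
apply: (@le_trans _ _ (\sum_(g : gT)
    #|avoiding_sets (fun x => g * x^-1)%g 1%g k|)%:R).
  rewrite ler_nat; apply: leq_trans (subset_leq_card _) _.
    exact: connection_sets_diam_neq2_sub.
  elim/big_rec2: _ => [|g m X _ leXm]; first by rewrite cards0.
  by apply: leq_trans (leq_card_setU _ _) _; rewrite leq_add2l.
rewrite natr_sum -mulrA mulr_natl -sumr_const; apply: ler_sum => g _.
rewrite cO; apply: card_avoiding_sets_le; last exact: ltnW.
by move=> x y /mulgI/invg_inj.
Qed.

(** * Asymptotic estimates and conclusion *)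

Lemma powR_nat_ge (R : realType) (beta M : R) : 0 < beta ->
  exists N : nat, forall n : nat, (N <= n)%N -> M <= n%:R `^ beta.
Proof.
move=> b0; pose M' := Num.max M 0.
have M0 : 0 <= M' by rewrite le_max lexx orbT.
exists (Num.truncn (M' `^ beta^-1)).+1 => n le_Nn.
apply: (@le_trans _ _ M'); first by rewrite le_max lexx.
have -> : M' = (M' `^ beta^-1) `^ beta.
  by rewrite -powRrM mulVf ?gt_eqF // powRr1.
apply: ge0_ler_powR; rewrite ?nnegrE ?powR_ge0 ?(ltW b0) //.
apply: le_trans (ltW (truncnS_gt _)) _.
by rewrite ler_nat.
Qed.

(** The exponential [expR (c * n ^ beta)] is at least [n ^ 2 / K] for a constant [K], so the product
    is at most [K / n]. *)
Lemma mul_expR_powR_le (R : realType) (beta c eps : R) :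
  0 < beta -> 0 < c -> 0 < eps ->
  exists N : nat, forall n : nat, (N <= n)%N ->
    n%:R * expR (- (c * n%:R `^ beta)) <= eps.
Proof.
move=> b0 c0 e0; pose m := (Num.truncn (2 / beta)).+1.
have m0 : 0 < m%:R :> R by rewrite ltr0n.
have mb : 2 <= beta * m%:R.
  by rewrite mulrC -ler_pdivrMr // ltW // truncnS_gt.
pose K : R := (m%:R / c) ^+ m.
exists (maxn 1 (Num.truncn (K / eps)).+1) => n; rewrite geq_max => /andP[n1 ltKn].
have n0 : 0 < n%:R :> R by rewrite ltr0n.
have Kn : K <= eps * n%:R.
  rewrite mulrC -ler_pdivrMr //; apply: le_trans (ltW (truncnS_gt _)) _.
  by rewrite ler_nat.
(* [expR y = expR (y / m) ^+ m >= (y / m) ^+ m] with [m >= 2 / beta] *)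
have le_exp : n%:R ^+ 2 / K <= expR (c * n%:R `^ beta).
  rewrite [X in expR X](_ : _ = m%:R * (c * n%:R `^ beta / m%:R)); last first.
    by rewrite [RHS]mulrC divfK // gt_eqF.
  rewrite expRM_natl.
  apply: (@le_trans _ _ ((c * n%:R `^ beta / m%:R) ^+ m)); last first.
    rewrite lerXn2r ?nnegrE ?expR_ge0 ?divr_ge0 ?mulr_ge0 ?powR_ge0 ?(ltW c0) //.
    by apply: le_trans (expR_ge1Dx _); rewrite lerDr.
  rewrite [X in X ^+ m](_ : _ = n%:R `^ beta * (m%:R / c)^-1); last first.
    by rewrite invf_div; ring.
  rewrite exprMn exprVn -/K ler_wpM2r ?invr_ge0 ?exprn_ge0 ?divr_ge0 ?(ltW c0) //.
  rewrite -(powR_mulrn _ (powR_ge0 _ _)) -powRrM -powR_mulrn //.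
  by apply: ler_powR => //; rewrite ler1n.
have K0 : 0 < K by rewrite exprn_gt0 // divr_gt0.
rewrite expRN ler_pdivrMr ?expR_gt0 //.
apply: le_trans (ler_wpM2l (ltW e0) le_exp).
rewrite mulrA ler_pdivlMr // expr2 mulrCA ler_wpM2l // ltW //.
Qed.

Theorem theorem4p5 (R : realType) (alpha : R)
    (alpha_gt : 1 / 2 < alpha) (alpha_lt : alpha < 1) :
  forall eps : R, 0 < eps ->
  exists N : nat, forall gT : finGroupType,
    elementary_abelian gT -> (N <= #|gT|)%N ->
    1 - eps <=
      unif_prob R (connection_sets gT (Num.truncn (#|gT|%:R `^ alpha)))
        [set S : {set gT} | diam (Cay S) == Some 2%N].
Proof.
move=> eps eps0.
have b0 : 0 < 2 * alpha - 1 by lra.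
have a0 : 0 < alpha by lra.
have a1 : 0 < 1 - alpha by lra.
(* With [x = n ^ alpha >= 8] and [k > x - 1] one has [4 k (k - 3) >= x ^ 2], whence the exponent is
   at least [x ^ 2 / (8 n)]. *)
have c0 : 0 < 8^-1 :> R by lra.
have [N1 exp_small] := mul_expR_powR_le b0 c0 eps0.
have [N2 pow_large] := powR_nat_ge 8 a0.
have [N3 copow_large] := powR_nat_ge 2 a1.
exists (maxn 3 (maxn N1 (maxn N2 N3))) => gT _.
rewrite !geq_max => /and4P[n3 /exp_small le_eps /pow_large le8 /copow_large le2].
set n := #|gT| in n3 le_eps le8 le2 *; set x := n%:R `^ alpha in le8 *.
have n0 : 0 < n%:R :> R by rewrite ltr0n; lia.
have n_neq0 : n%:R != 0 :> R by rewrite gt_eqF.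
have n1_0 : 0 < n.-1%:R :> R by rewrite ltr0n; lia.
have nE : n.-1%:R = n%:R - 1 :> R.
  by rewrite -subn1 natrB // (leq_trans _ n3).
have n3R : 3 <= n%:R :> R by rewrite ler_nat.
set k := Num.truncn x.
have x0 : 0 <= x by rewrite powR_ge0.
have le_kx : k%:R <= x by rewrite truncn_le.
have lt_xk : x < k%:R + 1 by rewrite natr1 truncnS_gt.
(* From [n ^ (1 - alpha) >= 2]; then [k <= n / 2 < n - 1] because [n >= 3]. *)
have xn : x * 2 <= n%:R.
  have -> : n%:R = x * n%:R `^ (1 - alpha) :> R.
    by rewrite -powRD ?n_neq0 ?implybT // subrKC powRr1 // ltW.
  by rewrite ler_wpM2l.
have lt_kn : (k < n.-1)%N by rewrite -(ltr_nat R) nE; lra.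
apply: le_trans (diam2_prob_ge R lt_kn); rewrite -/n lerD2l lerN2.
apply: le_trans le_eps; rewrite ler_wpM2l ?(ltW n0) //.
rewrite ler_expR lerN2.
have -> : n%:R `^ (2 * alpha - 1) = x ^+ 2 / n%:R.
  rewrite powRD ?n_neq0 ?implybT // powR_inv1 ?(ltW n0) //.
  by congr (_ / _); rewrite mulrC powRrM powR_mulrn.
(* Replacing [n - 1] by [n] lowers the quotient, as [k > 7] makes the numerator nonnegative. *)
apply: (@le_trans _ _ (k%:R * (k%:R - 3) / (2 * n%:R))); last first.
  rewrite ler_wpM2l ?mulr_ge0 //; first by lra.
  by rewrite lef_pV2 ?posrE ?mulr_gt0 // ler_wpM2l // nE; lra.
rewrite invfM !mulrA ler_wpM2r ?invr_ge0 ?(ltW n0) //.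
nra.
Qed.
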